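(* There exists a family of unweighted graphs under stochastic rewards and adversarial arrivals for which SimpleGreedy achieves a competitive ratio of at most $1/2$, even when all edges have uniform probability $p = O(1/n)$.
   Context: Setting: online bipartite matching with stochastic rewards. There is a bipartite graph with a set $U$ of offline vertices (known in advance) and a set $V$ of online vertices, which arrive one at a time in an order chosen by an adversary. Each edge $(u,v)$ exists independently with a known probability $p_{u,v}$, whose existence is only revealed when it is probed. In the probe-commit model, if a probed edge exists, it must be irrevocably added to the matching. In the stochastic rewards setting, each online vertex has patience $1$: when $v$ arrives, at most one incident edge $(u,v)$ to a still-unmatched offline vertex $u$ may be probed, after which $v$ departs. The graph is unweighted, so each successful match earns reward $1$. An opportunistic algorithm always probes an edge incident to an arriving online vertex $v$ if one to an unmatched offline neighbor exists. SimpleGreedy is the opportunistic algorithm that, when $v\in V$ arrives, chooses an unmatched neighbor $u\in U$ of $v$ arbitrarily (ties can be broken adversarially) and probes $(u,v)$. The competitive ratio compares the algorithm's expected matching size to that of an optimal offline (adaptive) probing algorithm, in the worst case over graphs and arrival orders. It is known (Mehta and Panigrahi 2012) that any opportunistic algorithm, including SimpleGreedy, is at least $1/2$-competitive in this setting. *)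

(* Defs.v *)
From HB Require Import structures.
From mathcomp Require Import all_boot all_order all_algebra.
From mathcomp Require Import all_classical all_reals all_analysis.

Set Implicit Arguments.
Unset Strict Implicit.
Unset Printing Implicit Defensive.

Import Order.TTheory GRing.Theory Num.Theory.
Import numFieldNormedType.Exports.

Local Open Scope ring_scope.

(* A stochastic bipartite graph. The value of [prob] on a pair that is not
   an edge is irrelevant. *)
Record stoch_graph (R : realType) := StochGraph {
  offline : finType;
  online : finType;
  edge : offline -> online -> bool;
  prob : offline -> online -> R;
  prob_ge0_le1 : forall u v, 0 <= prob u v <= 1 }.

Section Model.
Context (R : realType) (G : stoch_graph R).

Local Notation U := (offline G).
Local Notation V := (online G).

Definition edges : {set U * V} := finset (fun e => edge e.1 e.2).

(* A realization is the set of edges that exist. *)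
Definition realization_pr (w : {set U * V}) : R :=
  \prod_(e in edges)
    (if e \in w then prob e.1 e.2 else 1 - prob e.1 e.2).

Definition expect (f : {set U * V} -> R) : R :=
  \sum_(w in powerset edges) realization_pr w * f w.

(* The probes made so far, most recent first, each with its outcome. *)
Definition history := seq ((U * V) * bool).

Definition matching (h : history) : {set U * V} :=
  finset (fun e => (e, true) \in h).

Definition matched (h : history) (u : U) : bool :=
  [exists v, (u, v) \in matching h].

Definition probed (h : history) (v : V) : bool :=
  v \in [seq x.1.2 | x <- h].

Definition free_neighbors (h : history) (v : V) : {set U} :=
  finset (fun u => edge u v && ~~ matched h u).

(* Algorithms see the realization only through the history. They are
   deterministic functions of it: this loses nothing either for the best
   offline algorithm or for adversarial tie-breaking. *)
Definition offline_alg := history -> option (U * V).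

Definition online_alg := history -> V -> option U.

(* Probe-commit is enforced by [free_neighbors] and unit patience by [probed];
   an inadmissible proposal stops the algorithm. *)
Definition offline_admissible (h : history) (e : U * V) : bool :=
  (e.1 \in free_neighbors h e.2) && ~~ probed h e.2.

Fixpoint offline_run (k : nat) (A : offline_alg) (w : {set U * V})
    (h : history) : history :=
  if k is k'.+1 then
    if A h is Some e then
      if offline_admissible h e then offline_run k' A w ((e, e \in w) :: h)
      else h
    else h
  else h.

(* By unit patience no admissible run makes more than #|V| probes. *)
Definition offline_value (A : offline_alg) : R :=
  expect (fun w => #|matching (offline_run #|V| A w [::])|%:R).

Definition opt : R := sup (range offline_value).

(* The tie-breaking is part of [A], which may use the whole past. *)
Definition is_simple_greedy (A : online_alg) : Prop :=
  forall h v,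
    if A h v is Some u then u \in free_neighbors h v
    else free_neighbors h v == finset.set0.

Definition online_step (A : online_alg) (w : {set U * V})
    (h : history) (v : V) : history :=
  if A h v is Some u then ((u, v), (u, v) \in w) :: h else h.

Definition online_run (A : online_alg) (s : seq V) (w : {set U * V}) :
  history := foldl (online_step A w) [::] s.

Definition online_value (A : online_alg) (s : seq V) : R :=
  expect (fun w => #|matching (online_run A s w)|%:R).

Definition is_arrival_order (s : seq V) : Prop := perm_eq s (enum V).

(* Worst case over arrival orders and over the ways of breaking ties. *)
Definition simple_greedy_ratio : \bar R :=
  ereal_inf [set r : \bar R | exists (s : seq V) (A : online_alg),
    [/\ is_arrival_order s, is_simple_greedy A
      & r = (online_value A s / opt)%:E]]%classic.

End Model.

(* Main.v *)
(* The offline side is split into a block B of about n/2 vertices and its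
   complement. A first batch of |B| n online vertices is adjacent to every
   offline vertex, a second batch of the same size only to B; all edges have
   probability 1/n, so each batch yields about |B| successes as long as it
   finds free neighbors. Greedy may spend the first batch on B, after which the
   second batch is nearly useless: it gains |B| + O(sqrt n). Sending the first
   batch to the complement of B and the second one to B gains
   2 |B| - O(sqrt n). Both error terms come from the pointwise bound
   max(z, 0) <= (z + c)^2 / (4 c), whose expectation along a run is an explicit
   martingale; c is taken of order sqrt n. *)
Require Import Defs.
From HB Require Import structures.
From mathcomp Require Import all_boot all_order all_algebra.
From mathcomp Require Import all_classical all_reals all_analysis.
From mathcomp Require Import ring lra.

Set Implicit Arguments.
Unset Strict Implicit.
Unset Printing Implicit Defensive.

Import Order.TTheory GRing.Theory Num.Theory.
Import numFieldNormedType.Exports.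

Local Open Scope classical_set_scope.
Local Open Scope ring_scope.

(** * Expectations over realizations and the deferral of random choices *)

Lemma sum_setU1 (R : nmodType) (T : finType) (e : T) (F : {set T} -> R) :
  \sum_w F w = \sum_(w : {set T} | e \notin w) (F (e |: w)%SET + F w).
Proof.
rewrite (bigID (fun w : {set T} => e \in w)) big_split /=; congr (_ + _).
rewrite (reindex_onto (fun w : {set T} => e |: w)%SET
  (fun w : {set T} => w :\ e)%SET) /=; last first.
  by move=> w ew; rewrite finset.setD1K.
apply: eq_bigl => w; rewrite finset.setU11 /=; apply/eqP/idP => [<-|ew].
  by rewrite finset.in_setD1 eqxx.
by rewrite finset.setU1K.
Qed.

Section Expectation.
Context (R : realType) (G : stoch_graph R).
Local Notation V := (online G).
Local Notation E := (offline G * online G)%type.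
Implicit Types (e : E) (w : {set E}) (f g : {set E} -> R).

(* Extends [realization_pr] by giving probability zero to the sets that
   contain a non-edge, so that [expect] becomes a sum over all sets. *)
Let weight w : R :=
  \prod_e (if e \in w then (if e \in edges G then prob e.1 e.2 else 0)
           else (if e \in edges G then 1 - prob e.1 e.2 else 1)).

Let expectE f : expect f = \sum_w weight w * f w.
Proof.
rewrite [RHS](bigID (fun w => w \in powerset (edges G))) /= [X in _ + X]big1.
  rewrite addr0; apply: eq_bigr => w; rewrite finset.powersetE => sw.
  congr (_ * _); rewrite /realization_pr /weight big_mkcond /=.
  apply: eq_bigr => e _; case: ifP => // eG; case: ifP => // ew.
  by move/fintype.subsetP/(_ _ ew): sw; rewrite eG.
move=> w; rewrite finset.powersetE => /fintype.subsetPn[e ew eG].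
by rewrite /weight (bigD1 e) //= ew (negbTE eG) !mul0r.
Qed.

Let weight_ge0 w : 0 <= weight w.
Proof.
apply: prodr_ge0 => e _; case/andP: (prob_ge0_le1 (s:=G) e.1 e.2) => p0 p1.
by do !case: ifP => _ //; rewrite subr_ge0.
Qed.

Lemma expect_cst c : @expect R G (fun=> c) = c.
Proof.
rewrite expectE -mulr_suml -[RHS]mul1r; congr (_ * _).
(* Distributivity turns the total weight into a product over the pairs, each factor being the sum of
   two complementary probabilities. *)
rewrite /weight -bigA_distr big1 // => e _.
case: ifP => _ /=; last by rewrite add0r.
by rewrite addrC subrK.
Qed.

Lemma expect_le f g : (forall w, f w <= g w) -> expect f <= expect g.
Proof. by move=> fg; rewrite !expectE ler_sum // => w _; rewrite ler_wpM2l. Qed.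

Lemma eq_expect f g : f =1 g -> expect f = expect g.
Proof. by move=> /funext ->. Qed.

(** Deferred decisions: [F b] does not look at [e], so pairing [w] with [e |: w] isolates the factor
    of [e] in the weights, and the outcome at [e] can be drawn first. *)
Lemma expect_reveal e (F : bool -> {set E} -> R) :
  e \in edges G ->
  (forall b w w', (forall e', e' != e -> (e' \in w) = (e' \in w')) ->
    F b w = F b w') ->
  expect (fun w => F (e \in w) w) =
  prob e.1 e.2 * expect (F true) + (1 - prob e.1 e.2) * expect (F false).
Proof.
move=> eG Fe; rewrite !expectE !(sum_setU1 e) !mulr_sumr -big_split /=.
apply: eq_bigr => w ew; rewrite finset.setU11 (negbTE ew).
have FU b : F b (e |: w)%SET = F b w.
  by apply: Fe => e' e'e; rewrite finset.in_setU1 (negbTE e'e).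
(* The common factor [q] is the weight of all pairs other than [e]. *)
have {Fe} : exists q, weight (e |: w)%SET = prob e.1 e.2 * q /\
    weight w = (1 - prob e.1 e.2) * q.
  rewrite /weight; eexists; split.
    rewrite (bigD1 e) //= finset.setU11 eG; congr (_ * _); exact: erefl.
  rewrite (bigD1 e) //= (negbTE ew) eG; congr (_ * _).
  by apply: eq_bigr => e' e'e; rewrite finset.in_setU1 (negbTE e'e).
by move=> [q [-> ->]]; rewrite !FU; ring.
Qed.

Implicit Types h : history G.

(** By unit patience a run never probes again at a probed online vertex. This gives the independence
    that [expect_reveal] requires after the first probe. *)
Lemma offline_run_eq k A w w' h :
  (forall e, ~~ probed h e.2 -> (e \in w) = (e \in w')) ->
  offline_run k A w h = offline_run k A w' h.
Proof.
elim: k h => //= k IH h ww'; case: (A h) => // e.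
case: ifP => // /andP[_ he]; rewrite ww' //; apply: IH => e'.
by rewrite /probed /= inE negb_or => /andP[_ /ww'].
Qed.

Lemma offline_run_reveal k A h e (f : history G -> R) :
  A h = Some e -> offline_admissible h e ->
  expect (fun w => f (offline_run k.+1 A w h)) =
  prob e.1 e.2 * expect (fun w => f (offline_run k A w ((e, true) :: h)))
  + (1 - prob e.1 e.2) *
    expect (fun w => f (offline_run k A w ((e, false) :: h))).
Proof.
move=> Ah adm.
rewrite -(expect_reveal (e := e)
  (F := fun b w => f (offline_run k A w ((e, b) :: h)))).
- by apply: eq_expect => w /=; rewrite Ah adm.
- by case/andP: adm; rewrite !inE => /andP[].
- move=> b w w' ww'; congr f; apply: offline_run_eq => e'.
  rewrite /probed /= inE negb_or => /andP[e'e _]; apply: ww'.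
  by apply: contra e'e => /eqP ->.
Qed.

Lemma foldl_online_step_eq A s w w' h :
  (forall e, e.2 \in s -> (e \in w) = (e \in w')) ->
  foldl (online_step A w) h s = foldl (online_step A w') h s.
Proof.
elim: s h => //= v s IH h ww'.
rewrite (_ : online_step A w h v = online_step A w' h v); last first.
  by rewrite /online_step; case: (A h v) => // u; rewrite ww' //= mem_head.
by apply: IH => e es; apply: ww'; rewrite inE es orbT.
Qed.

Lemma online_run_reveal A h u v s (f : history G -> R) :
  A h v = Some u -> edge u v -> v \notin s ->
  expect (fun w => f (foldl (online_step A w) h (v :: s))) =
  prob u v * expect (fun w =>
    f (foldl (online_step A w) ((u, v, true) :: h) s))
  + (1 - prob u v) * expect (fun w =>
    f (foldl (online_step A w) ((u, v, false) :: h) s)).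
Proof.
move=> Ahv uv vs.
rewrite -(expect_reveal (e := (u, v))
  (F := fun b w => f (foldl (online_step A w) ((u, v, b) :: h) s))).
- by apply: eq_expect => w /=; rewrite /online_step Ahv.
- by rewrite inE.
- move=> b w w' ww'; congr f; apply: foldl_online_step_eq => e es.
  by apply: ww'; apply: contraNneq vs => eE; rewrite eE in es.
Qed.

Lemma offline_value_le_opt (A : offline_alg G) : offline_value A <= opt G.
Proof.
apply: ub_le_sup; last by exists A.
(* The supremum is an upper bound only for a bounded set of values; the number of pairs bounds every
   matching. *)
exists #|{: E}|%:R => _ [B _ <-]; rewrite -[leRHS]expect_cst.
by apply: expect_le => w; rewrite ler_nat max_card.
Qed.

Lemma matching_true h e :
  matching ((e, true) :: h) = (e |: matching h)%SET.
Proof. by apply/finset.setP => e'; rewrite !inE xpair_eqE andbT. Qed.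

Lemma matching_false h e : matching ((e, false) :: h) = matching h.
Proof. by apply/finset.setP => e'; rewrite !inE xpair_eqE andbF. Qed.

Lemma notin_matching h e : ~~ matched h e.1 -> e \notin matching h.
Proof. by apply: contra => eh; apply/existsP; exists e.2; case: e eh. Qed.

(** The first projection maps the selected part of the matching onto a superset of [X]. *)
Lemma card_le_matched h (X : {set offline G}) (M : {set E}) :
  (forall u, u \in X -> exists2 v, (u, v) \in matching h & (u, v) \in M) ->
  (#|X| <= #|[set e in matching h | e \in M]%SET|)%N.
Proof.
move=> XM; apply: leq_trans (leq_imset_card fst _); apply: subset_leq_card.
apply/fintype.subsetP => u /XM[v uv uvM]; apply/imsetP; exists (u, v) => //.
by rewrite !inE /= in uv *; rewrite uv.
Qed.

End Expectation.

Lemma card_ltn_ord (n b : nat) : (b <= n)%N ->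
  #|[set u : 'I_n | (u < b)%N]%SET| = b.
Proof.
move=> bn; rewrite -sum1dep_card -(big_ord_widen n (fun=> 1%N) bn).
by rewrite sum1_card card_ord.
Qed.

(** * A quadratic potential bounding a positive part *)

Section Potential.
Context (R : realType) (p c : R) (hp : 0 <= p <= 1) (c0 : 0 < c).

Let p_ge0 : 0 <= p. Proof. by case/andP: hp. Qed.

Let q_ge0 : 0 <= 1 - p. Proof. by rewrite subr_ge0; case/andP: hp. Qed.

(* With [S] the sum of [x] and a binomial variable of parameters [r] and [p],
   this is the expectation of [(S - a + c) ^ 2 / (4 c)], which bounds the
   positive part of [S - a] from above. *)
Definition excess (a x r : R) : R :=
  ((x + r * p - a + c) ^+ 2 + r * p * (1 - p)) / (4 * c).

(** Martingale identity: condition on the first of the [r + 1] trials. *)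
Lemma excessS (a x r : R) :
  excess a x (r + 1) = p * excess a (x + 1) r + (1 - p) * excess a x r.
Proof. by rewrite /excess; field; rewrite gt_eqF. Qed.

Lemma excess_ge0 (a x r : R) : 0 <= r -> 0 <= excess a x r.
Proof.
move=> r0; apply: divr_ge0; last by move: c0; lra.
by rewrite addr_ge0 ?sqr_ge0 // !mulr_ge0.
Qed.

(** With z the left-hand side, z <= (z + c)^2 / (4 c) amounts to (z - c)^2 >= 0, and the variance
    term only helps. *)
Lemma excess_ge (a x r : R) : 0 <= r -> x + r * p - a <= excess a x r.
Proof.
move=> r0; rewrite /excess ler_pdivlMr; last by move: c0; lra.
have : 0 <= r * p * (1 - p) by rewrite !mulr_ge0.
have := sqr_ge0 (x + r * p - a - c); move: c0; nra.
Qed.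

(** Covers an arrival at which greedy makes no probe: once [x] has reached [a], the base of the
    square is positive, so a further trial can only increase the bound. *)
Lemma excess_incr (a x r : R) : a <= x -> 0 <= r -> excess a x r <= excess a x (r + 1).
Proof.
move=> ax r0; rewrite /excess ler_pM2r ?invr_gt0; last by move: c0; lra.
have rp : 0 <= r * p by rewrite !mulr_ge0.
have : 0 <= p * (1 - p) by rewrite !mulr_ge0.
have : 0 <= (x + r * p - a + c) * p by rewrite mulr_ge0 //; move: c0; lra.
by nra.
Qed.

End Potential.

(** * The graph with two batches, and the behavior of greedy on it *)

Section BlockGraph.
Context (R : realType) (n b m : nat) (p : R).
Context (hp : 0 <= p <= 1) (bn : (b <= n)%N).

(** The boolean of an online vertex is true for the first batch; the block B consists of the indices
    below [b]. *)
Definition block_graph : stoch_graph R :=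
  @StochGraph R 'I_n (bool * 'I_m)%type (fun u v => v.1 || (u < b)%N)
    (fun _ _ => p) (fun _ _ => hp).

Local Notation G := block_graph.
Local Notation E := (offline G * online G)%type.
Implicit Types (h : history G) (u : offline G) (v : online G) (e : E).

Definition block_greedy : online_alg G := fun h v =>
  if [pick u in free_neighbors h v | (u < b)%N] is Some u then Some u
  else [pick u in free_neighbors h v].

Lemma block_greedyP : is_simple_greedy block_greedy.
Proof.
move=> h v; rewrite /block_greedy; case: pickP => [u /andP[] //|_].
case: pickP => [u //|free0]; apply/eqP/finset.setP => u.
by rewrite finset.in_set0 -[RHS](free0 u).
Qed.

Lemma block_greedy_small h v u : block_greedy h v = Some u -> (b <= u)%N ->
  v.1 -> forall u', (u' < b)%N -> matched h u'.
Proof.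
rewrite /block_greedy; case: pickP => [u1 /andP[_ u1b] [<-]|nosmall].
  by rewrite leqNgt u1b.
move=> _ _ v1 u' u'b; have := nosmall u'.
by rewrite !inE /= v1 u'b /= andbT => /negbFE.
Qed.

Lemma inj_matching_true h u v : {in matching h &, injective fst} ->
  ~~ matched h u -> {in matching (((u, v), true) :: h) &, injective fst}.
Proof.
move=> inj uh e e'; rewrite matching_true => /finset.setU1P[->|eh].
  move=> /finset.setU1P[-> //|e'h] /= ue'; case/negP: uh; rewrite ue'.
  by apply: contraLR e'h => /notin_matching.
move=> /finset.setU1P[->|e'h] /= ue'; last exact: inj.
by case/negP: uh; rewrite -ue'; apply: contraLR eh => /notin_matching.
Qed.

Lemma card_matching_true h u v : ~~ matched h u ->
  #|matching (((u, v), true) :: h)| = #|matching h|.+1.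
Proof.
by move=> uh; rewrite matching_true finset.cardsU1 notin_matching.
Qed.

Lemma card_matching_small h : {in matching h &, injective fst} ->
  {in matching h, forall e, (e.1 < b)%N} -> (#|matching h| <= b)%N.
Proof.
move=> inj small; rewrite -(finset.card_in_imset inj) -[leqRHS](card_ltn_ord bn).
apply: subset_leq_card; apply/fintype.subsetP => u /imsetP[e eh ->].
by rewrite inE small.
Qed.

Lemma card_matching_ge h : (forall u, (u < b)%N -> matched h u) ->
  (b <= #|matching h|)%N.
Proof.
move=> allm; rewrite -[leqLHS](card_ltn_ord bn).
apply: leq_trans (card_le_matched (h := h) (M := finset.setT) _) _.
  move=> u; rewrite inE => /allm /existsP[v uv]; by exists v => //; rewrite finset.in_setT.
by apply/subset_leq_card/fintype.subsetP => e; rewrite inE => /andP[].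
Qed.

(** The disjunction reflects the two phases of the first batch: greedy stays inside B until B is
    exhausted. *)
Definition greedy_invariant h :=
  {in matching h &, injective fst} /\
  ({in matching h, forall e, (e.1 < b)%N} \/
   forall u, (u < b)%N -> matched h u).

(** If only B has been used, the second batch also stays in B and injectivity caps the matching at
    [b]. If B is exhausted, no vertex of the second batch has a free neighbor. *)
Lemma card_matching_second_batch w h s :
  greedy_invariant h -> {in s, forall v, ~~ v.1} ->
  (#|matching (foldl (online_step block_greedy w) h s)|
     <= maxn #|matching h| b)%N.
Proof.
move=> [inj [small|allm]] s2.
  apply: leq_trans (leq_maxr _ _).
  elim: s h inj small s2 => [|v s IH] h inj small s2 /=.
    exact: card_matching_small.
  have s2' : {in s, forall v, ~~ v.1}.
    by move=> v' v's; apply: s2; rewrite inE v's orbT.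
  rewrite /online_step; case Ahv: (block_greedy h v) => [u|]; last exact: IH.
  have := block_greedyP h v; rewrite Ahv inE => /andP[/= uv uh].
  case: (_ \in w); last by apply: IH; rewrite ?matching_false.
  apply: IH => //; first exact: inj_matching_true.
  move=> e; rewrite matching_true => /finset.setU1P[->|/small //] /=.
  by move: uv; rewrite (negbTE (s2 v (mem_head _ _))).
apply: leq_trans (leq_maxl _ _); elim: s s2 => //= v s IH s2.
rewrite {2}/online_step; case Ahv: (block_greedy h v) => [u|].
  have := block_greedyP h v; rewrite Ahv inE => /andP[/= uv /negP[]].
  by move: uv; rewrite (negbTE (s2 v (mem_head _ _))) => /allm.
by apply: IH => v' v's; apply: s2; rewrite inE v's orbT.
Qed.

(** * Upper bound on the value of greedy *)

Section Bounds.
Context (c : R) (c0 : 0 < c).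
Local Notation excess := (excess p c).

(** Induction on the first batch: the right-hand side is preserved on average by a probe ([excessS])
    and does not increase when greedy is idle ([excess_incr]). *)
Lemma expect_greedy h s1 s2 :
  greedy_invariant h -> {in s1, forall v, v.1} -> {in s2, forall v, ~~ v.1} ->
  uniq s1 ->
  expect (fun w =>
    #|matching (foldl (online_step block_greedy w) h (s1 ++ s2))|%:R) <=
  b%:R + excess b%:R #|matching h|%:R (size s1)%:R.
Proof.
elim: s1 h => [|v s1 IH] h inv batch1 batch2 /=.
  move=> _; rewrite -[leRHS](expect_cst G); apply: expect_le => w.
  apply: (@le_trans _ _ (maxn #|matching h| b)%:R).
    by rewrite ler_nat card_matching_second_batch.
  (* With no trial left, [excess] dominates the positive part of the matching size minus [b], hence
     the right-hand side dominates the maximum. *)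
  have := excess_ge hp c0 b%:R #|matching h|%:R (lexx (0 : R)).
  have := excess_ge0 hp c0 b%:R #|matching h|%:R (lexx (0 : R)).
  by rewrite /maxn; case: ifP => _; lra.
move=> /andP[vs1 uniq1].
have v1 : v.1 by apply: batch1; rewrite mem_head.
have {}batch1 : {in s1, forall v, v.1}.
  by move=> v' v's; apply: batch1; rewrite inE v's orbT.
have vs : v \notin s1 ++ s2.
  rewrite mem_cat negb_or vs1 /=; apply/negP => /batch2; by rewrite v1.
have [inj prefers] := inv; have := block_greedyP h v.
case Ahv: (block_greedy h v) => [u|] freeh; last first.
  (* A vertex of the first batch sees every offline vertex, so greedy is idle only when all are
     matched; the matching then has size at least [b], as [excess_incr] requires. *)
  have allm u : matched h u.
    apply: contraPT (eqP freeh) => uh /finset.setP /(_ u).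
    by rewrite !inE /= v1 uh.
  rewrite (_ : (fun w => _) = fun w => #|matching
      (foldl (online_step block_greedy w) h (s1 ++ s2))|%:R); last first.
    by apply/funext => w; rewrite /online_step Ahv.
  apply: le_trans (IH h inv batch1 batch2 uniq1) _.
  rewrite lerD2l -natr1 excess_incr // ler_nat.
  exact: card_matching_ge.
move: freeh; rewrite inE => /andP[uv uh].
have inv_false : greedy_invariant ((u, v, false) :: h).
  split; rewrite ?matching_false //; case: prefers => [|allm]; [by left|right].
  by move=> u' /allm; rewrite /matched matching_false.
have inv_true : greedy_invariant ((u, v, true) :: h).
  split; first exact: inj_matching_true.
  have grow u' : matched h u' -> matched ((u, v, true) :: h) u'.
    move=> /existsP[v' uv']; apply/existsP; exists v'.
    by rewrite matching_true finset.in_setU1 uv' orbT.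
  case: prefers => [small|allm]; last by right=> u' /allm /grow.
  (* A choice outside B shows that B is already exhausted, which starts the second phase. *)
  have [bu|ub] := leqP b u; [right=> u' u'b|left=> e].
    exact/grow/(block_greedy_small Ahv bu v1 u'b).
  by rewrite matching_true => /finset.setU1P[->|/small].
have := online_run_reveal (fun h => #|matching h|%:R) Ahv uv vs.
move=> /= ->; rewrite -natr1 excessS //.
have := IH _ inv_true batch1 batch2 uniq1.
have := IH _ inv_false batch1 batch2 uniq1.
rewrite card_matching_true // matching_false -natr1.
set X := expect _; set Y := expect _; move=> XY1 YX1.
have [p0 p1] := andP hp.
have : p * Y <= p * (b%:R + excess b%:R (#|matching h|%:R + 1) (size s1)%:R).
  exact: ler_wpM2l.
have : (1 - p) * X <= (1 - p) * (b%:R + excess b%:R #|matching h|%:R (size s1)%:R).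
  by apply: ler_wpM2l => //; lra.
by lra.
Qed.

Lemma card_batch (t : bool) :
  #|[set v : online G | v.1 == t]%SET| = m.
Proof.
transitivity #|finset.setX [set t]%SET [set: 'I_m]%SET|; last first.
  by rewrite finset.cardsX finset.cards1 finset.cardsT card_ord mul1n.
by congr #|pred_of_set _|; apply/finset.setP => v; rewrite !inE andbT.
Qed.

Definition batch_order : seq (online G) :=
  [seq v <- enum (online G) | v.1] ++
  [seq v <- enum (online G) | ~~ v.1].

Lemma batch_orderP : is_arrival_order batch_order.
Proof. exact: permEl (perm_filterC _ _). Qed.

Lemma greedy_value_le :
  online_value block_greedy batch_order <= b%:R + excess b%:R 0 m%:R.
Proof.
have no_match : matching ([::] : history G) = finset.set0.
  by apply/finset.setP => e; rewrite !inE.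
have sizeE : size ([seq v <- enum (online G) | v.1]) = m.
  rewrite enumT; transitivity #|[set v : online G | v.1 == true]%SET|.
    rewrite cardE /enum_mem; congr size.
    apply: seq.eq_filter => v; rewrite -[LHS]eqb_id; apply: esym.
    exact: (@finset.in_set (online G)).

  exact: card_batch.
apply: le_trans (expect_greedy (h := [::]) _ _ _ _) _.
- split; last left; by move=> e; rewrite no_match inE.
- by move=> v; rewrite mem_filter => /andP[].
- by move=> v; rewrite mem_filter => /andP[].
- by rewrite filter_uniq // enum_uniq.
- by rewrite no_match finset.cards0 sizeE.
Qed.

(** * Lower bound on the optimum by separating the two batches *)

Definition split_pair e := (e.1 < b)%N != e.2.1.

(** The first batch is sent to the complement of B and the second to B. The batches thus compete for
    disjoint offline sets and can be analyzed separately. *)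
Definition split_alg : offline_alg G := fun h =>
  [pick e | offline_admissible h e && split_pair e].

Definition batch_matched (t : bool) h : nat :=
  #|[set e in matching h | e \in [set e : E | e.2.1 == t]]%SET|.

Definition batch_left (t : bool) h : nat :=
  #|[set v : online G | (v.1 == t) && ~~ probed h v]%SET|.

(** With S the final number of successes of batch [t] if it never ran out of free vertices, and a
    the size of its side, this is a lower bound for the expectation of min(S, a) = S - max(S - a,
    0). *)
Definition batch_potential (t : bool) h : R :=
  let r := (batch_left t h)%:R in
  (batch_matched t h)%:R + r * p
    - excess (if t then n - b else b)%N%:R (batch_matched t h)%:R r.

Lemma batch_matchedD h :
  (batch_matched true h + batch_matched false h)%N = #|matching h|.
Proof.
rewrite -(finset.cardsID [set e : E | e.2.1 == true]%SET (matching h)).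
congr (_ + _)%N; congr #|pred_of_set _|; apply/finset.setP => e; rewrite !inE //.
by case: e.2.1; rewrite ?andbF ?andbT.
Qed.

Lemma batch_left_cons t e o h : ~~ probed h e.2 ->
  batch_left t h = (batch_left t ((e, o) :: h) + (e.2.1 == t))%N.
Proof.
move=> eh; rewrite /batch_left (finset.cardsD1 e.2) inE eh andbT addnC.
congr (_ + _)%N; congr #|pred_of_set _|; apply/finset.setP => v.
by rewrite !inE /probed /= inE negb_or; case: (v == e.2); rewrite ?andbF.
Qed.

Lemma batch_matched_true t e h : ~~ matched h e.1 ->
  batch_matched t ((e, true) :: h) = (batch_matched t h + (e.2.1 == t))%N.
Proof.
move=> eh; rewrite /batch_matched (finset.cardsD1 e) matching_true !inE eqxx /=.
rewrite addnC; congr (_ + _)%N; congr #|pred_of_set _|.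
apply/finset.setP => e'; rewrite !inE; case: eqP => //= ->.
by have := notin_matching eh; rewrite inE => /negbTE ->.
Qed.

(** A probe in batch [t] uses up one of its trials, and [excessS] gives the martingale property; a
    probe in the other batch changes nothing. *)
Lemma batch_potential_cons t e h : ~~ probed h e.2 -> ~~ matched h e.1 ->
  batch_potential t h = p * batch_potential t ((e, true) :: h)
    + (1 - p) * batch_potential t ((e, false) :: h).
Proof.
move=> eprobed ematched; rewrite /batch_potential.
have := batch_left_cons t true eprobed; have := batch_left_cons t false eprobed.
set r := batch_left t ((e, false) :: h) => ->.
move=> /eqP; rewrite eqn_add2r => /eqP <-; rewrite batch_matched_true //.
rewrite [batch_matched t ((e, false) :: h)]/batch_matched matching_false.
rewrite -/(batch_matched t h) !natrD; set a := (X in excess X).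
case: (e.2.1 == t) => /=; last by rewrite !addr0; ring.
by rewrite excessS //; ring.
Qed.

(** The two cases are those in which a batch can stop. Without trials left, [excess] is nonnegative;
    with a full side, [excess_ge] bounds the potential by the size of the side. *)
Lemma batch_potential_le t h :
  (batch_left t h = 0%N \/
   (if t then n - b else b) <= batch_matched t h)%N ->
  batch_potential t h <= (batch_matched t h)%:R.
Proof.
rewrite /batch_potential; move: (if t then _ else _) => a.
have r0 : 0 <= (batch_left t h)%:R :> R by [].
move=> [->|]; first by have := excess_ge0 hp c0 a%:R (batch_matched t h)%:R (lexx 0); lra.
rewrite -(ler_nat R) => ax.
by have := excess_ge hp c0 a%:R (batch_matched t h)%:R r0; lra.
Qed.

(** An unprobed vertex of batch [t] could be proposed with any free vertex of its side, so that side
    is fully matched; since the matching has only split pairs, it is matched to batch [t] itself. *)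
Lemma split_alg_None h t : split_alg h = None ->
  {in matching h, forall e, split_pair e} ->
  batch_left t h = 0%N \/ ((if t then n - b else b) <= batch_matched t h)%N.
Proof.
rewrite /split_alg; case: pickP => // none _ hsplit.
case: (finset.set_0Vmem
    [set v : online G | (v.1 == t) && ~~ probed h v]%SET) => [left0|[v]].
  by left; rewrite /batch_left left0 finset.cards0.
rewrite inE => /andP[/eqP vt vh]; right.
have capE : #|[set u : 'I_n | (u < b)%N != t]%SET| = if t then (n - b)%N else b.
  have := card_ltn_ord bn; case: {vt} t => cardb; last first.
    by rewrite -[RHS]cardb; congr #|pred_of_set _|;
       apply/finset.setP => u; rewrite !inE; case: (_ < _)%N.
  apply: (@addnI b); rewrite subnKC // -[RHS]card_ord.
  rewrite -(finset.cardsC [set u : 'I_n | (u < b)%N]%SET) cardb.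
  by congr (_ + #|pred_of_set _|)%N; apply/finset.setP => u; rewrite !inE;
     case: (_ < _)%N.
rewrite -[leqLHS]capE; apply: card_le_matched => u; rewrite inE => ut.
have : matched h u.
  have := none (u, v); rewrite /offline_admissible !inE /= vh /split_pair /= vt.
  rewrite ut !andbT; case: (matched h u) => //=; rewrite andbT.
  by move: ut; case: t {vt capE} => //=; case: (_ < _)%N.
move=> /existsP[v' uv']; exists v' => //; rewrite inE /=.
have := hsplit _ uv'; rewrite /split_pair /=.
by move: ut; case: t {vt capE}; case: v'.1; case: (_ < _)%N.
Qed.

Lemma expect_split k h : {in matching h, forall e, split_pair e} ->
  (batch_left true h + batch_left false h <= k)%N ->
  batch_potential true h + batch_potential false h <=
  expect (fun w => #|matching (offline_run k split_alg w h)|%:R).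
Proof.
elim: k h => [|k IH] h hsplit hk.
  (* The fuel [k] bounds the number of unprobed vertices, so when it is exhausted both batches have
     been fully probed. *)
  rewrite /= expect_cst -batch_matchedD natrD lerD // batch_potential_le //; left.
    by apply/eqP; rewrite -leqn0 (leq_trans _ hk) ?leq_addr.
  by apply/eqP; rewrite -leqn0 (leq_trans _ hk) ?leq_addl.
case Ah: (split_alg h) => [e|]; last first.
  rewrite (_ : (fun w => _) = fun=> #|matching h|%:R); last first.
    by apply/funext => w /=; rewrite Ah.
  rewrite expect_cst -batch_matchedD natrD.
  by apply: lerD; apply: batch_potential_le; apply: split_alg_None.
have [adm esplit] : offline_admissible h e /\ split_pair e.
  by move: Ah; rewrite /split_alg; case: pickP => // e' /andP[? ?] [<-].
rewrite (offline_run_reveal k (fun h => #|matching h|%:R) Ah adm) /=.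
move: adm; rewrite /offline_admissible inE => /andP[/andP[_ em] ep].
rewrite !(batch_potential_cons _ ep em).
have left_le o : (batch_left true ((e, o) :: h)
    + batch_left false ((e, o) :: h) <= k)%N.
  move: hk; rewrite !(batch_left_cons _ o ep).
  by case: e.2.1; rewrite ?addn0 ?addn1 // ?addSn // addnS.
have IHt : batch_potential true ((e, true) :: h)
    + batch_potential false ((e, true) :: h) <=
    expect (fun w => #|matching (offline_run k split_alg w ((e, true) :: h))|%:R).
  apply: IH => // e'; rewrite matching_true => /finset.setU1P[->//|].
  exact: hsplit.
have IHf : batch_potential true ((e, false) :: h)
    + batch_potential false ((e, false) :: h) <=
    expect (fun w => #|matching (offline_run k split_alg w ((e, false) :: h))|%:R).
  by apply: IH => //; rewrite matching_false.
have [p0 p1] := andP hp.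
have q0 : 0 <= 1 - p by rewrite subr_ge0.
have := lerD (ler_wpM2l p0 IHt) (ler_wpM2l q0 IHf).
by rewrite !mulrDr addrACA.
Qed.

Lemma split_value_ge :
  2 * (m%:R * p) - excess (n - b)%:R 0 m%:R - excess b%:R 0 m%:R <= opt G.
Proof.
apply: le_trans (offline_value_le_opt split_alg).
have no_match : matching ([::] : history G) = finset.set0.
  by apply/finset.setP => e; rewrite !inE.
have left0 t : batch_left t [::] = m.
  rewrite -[RHS](card_batch t).
  by congr #|pred_of_set _|; apply/finset.setP => v; rewrite !inE andbT.
have matched0 t : batch_matched t [::] = 0%N.
  apply/eqP; rewrite finset.cards_eq0; apply/eqP/finset.setP => e.
  by rewrite !inE.
apply: le_trans (expect_split (k := #|online G|) (h := [::]) _ _).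
- by rewrite /batch_potential !left0 !matched0; lra.
- by move=> e; rewrite no_match inE.
- by rewrite !left0 card_prod card_bool card_ord mul2n addnn.
Qed.

End Bounds.
End BlockGraph.

(** * Choice of the parameters and asymptotics *)

Section HalfBlocks.
Context (R : realType) (n : nat).

Lemma leq_uphalf : (uphalf n <= n)%N.
Proof. by rewrite leq_uphalf_double -addnn leq_addr. Qed.

Lemma inv_nat_prob : 0 <= (n%:R^-1 : R) <= 1.
Proof.
(* For [n = 0] the inverse is 0 by convention, still a probability. *)
rewrite invr_ge0 ler0n /=; case: n => [|k]; first by rewrite invr0.
by rewrite invf_le1 // ler1n.
Qed.

(** The batch size makes the mean number of successes exactly the size of B. Rounding up keeps B
    nonempty for [n = 1], so that the optimum is positive there too. *)
Definition half_blocks : stoch_graph R :=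
  block_graph n (uphalf n) (uphalf n * n) inv_nat_prob.

Let b : R := (uphalf n)%:R.
(** The order of the standard deviation of a batch; the added 1 compensates the [- 1] that appears
    in [first_batch] below. *)
Let c : R := Num.sqrt (b + 1).

Hypothesis n0 : (0 < n)%N.

Let b_ge1 : 1 <= b.
Proof. by rewrite ler1n uphalf_gt0. Qed.

Let c_gt0 : 0 < c.
Proof. by rewrite sqrtr_gt0; move: b_ge1; lra. Qed.

Let c_sqr : c ^+ 2 = b + 1.
Proof. by rewrite sqr_sqrtr //; move: b_ge1; lra. Qed.

Let mean_batch : (uphalf n * n)%:R * n%:R^-1 = b.
Proof. by rewrite natrM mulfK // pnatr_eq0 -lt0n. Qed.

(** The middle term is the variance of the number of successes in a batch. *)
Let prob_batch : 0 <= b * (1 - n%:R^-1) <= b.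
Proof.
have /andP[p0 p1] := inv_nat_prob.
rewrite mulr_ge0 /=; [|by move: b_ge1; lra|by rewrite subr_ge0].
by rewrite ler_piMr ?gerBl //; move: b_ge1; lra.
Qed.

Lemma half_blocks_greedy :
  online_value (block_greedy (hp := inv_nat_prob))
    (batch_order n (uphalf n) (uphalf n * n) inv_nat_prob) <= b + c / 2.
Proof.
apply: le_trans (greedy_value_le _ _ leq_uphalf c_gt0) _.
rewrite lerD2l /excess mean_batch add0r subrr add0r c_sqr ler_pdivrMr; last first.
  by move: c_gt0; lra.
have -> : c / 2 * (4 * c) = 2 * c ^+ 2 by field.
by rewrite c_sqr; move: prob_batch; lra.
Qed.

Lemma half_blocks_opt : 2 * b - c - 1 / 2 <= opt half_blocks.
Proof.
apply: le_trans (split_value_ge _ _ leq_uphalf c_gt0).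
rewrite /excess mean_batch add0r subrr add0r.
(* The two sides differ by the parity of [n], which costs the extra 1 / 2 in the bound. *)
have [d0 d1] : 0 <= b - (n - uphalf n)%:R /\ b - (n - uphalf n)%:R <= 1.
  have : b *+ 2 = (odd n)%:R + n%:R by rewrite -natrD -uphalfK -mul2n natrM mulr_natl.
  by rewrite natrB ?leq_uphalf // -/b mulr2n; case: (odd n) => /=; lra.
move: d0 d1; set d := b - _ => d0 d1.
have first_batch : ((d + c) ^+ 2 + b * (1 - n%:R^-1)) / (4 * c) <= (c + 1) / 2.
  rewrite ler_pdivrMr; last by move: c_gt0; lra.
  have -> : (c + 1) / 2 * (4 * c) = (1 + c) ^+ 2 + c ^+ 2 - 1 by field.
  have : (d + c) ^+ 2 <= (1 + c) ^+ 2.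
    by rewrite ler_sqr ?nnegrE; move: c_gt0; lra.
  by move: c_sqr prob_batch; lra.
have second_batch : (c ^+ 2 + b * (1 - n%:R^-1)) / (4 * c) <= c / 2.
  rewrite ler_pdivrMr; last by move: c_gt0; lra.
  have -> : c / 2 * (4 * c) = 2 * c ^+ 2 by field.
  by move: c_sqr prob_batch; lra.
by move: first_batch second_batch; lra.
Qed.

Lemma half_blocks_opt_gt0 : 0 < opt half_blocks.
Proof.
apply: lt_le_trans half_blocks_opt.
by move: c_sqr b_ge1 c_gt0; nra.
Qed.

(** [K] is a lower bound for [c]. From 3 <= [c] the lower bound on the optimum is at least c^2, and
    e c^2 >= 2 c covers the deficit c + 1 / 4 between the bound on greedy and half the bound on the
    optimum. *)
Lemma half_blocks_ratio (e K : R) : 0 < e -> 3 <= K -> 2 <= e * K ->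
  2 * K ^+ 2 <= n%:R ->
  (simple_greedy_ratio half_blocks <= (2^-1 + e)%:E)%E.
Proof.
move=> e0 K3 eK Kn.
apply: (@le_trans _ _ (online_value (block_greedy (hp := inv_nat_prob))
    (batch_order n (uphalf n) (uphalf n * n) inv_nat_prob)
    / opt half_blocks)%:E).
  apply: ereal_inf_lbound; exists (batch_order _ _ _ inv_nat_prob).
  exists (block_greedy (hp := inv_nat_prob)).
  by split => //; [exact: batch_orderP|exact: block_greedyP].
rewrite lee_fin ler_pdivrMr ?half_blocks_opt_gt0 //.
apply: le_trans half_blocks_greedy _.
have e2 : 0 <= 2^-1 + e by lra.
apply: le_trans (ler_wpM2l e2 half_blocks_opt).
have nb : n%:R <= 2 * b by rewrite /b -natrM ler_nat mul2n uphalfK leq_addl.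
have Kc : K <= c.
  rewrite -(@ler_sqr R) ?nnegrE; [|lra|exact: ltW].
  by rewrite c_sqr; lra.
have ec : 2 <= e * c by apply: le_trans eK _; rewrite ler_pM2l.
have ecc : 2 * c <= e * c ^+ 2.
  by rewrite expr2 mulrA ler_pM2r.
have : e * c ^+ 2 <= e * (2 * b - c - 1 / 2).
  rewrite ler_pM2l //; have -> : b = c ^+ 2 - 1 by rewrite c_sqr addrK.
  have : 3 * c <= c ^+ 2 by rewrite expr2 ler_pM2r //; lra.
  by lra.
by lra.
Qed.

End HalfBlocks.

Theorem theorem8 (R : realType) :
  exists (G : nat -> stoch_graph R) (p : nat -> R),
    [/\ forall n, #|offline (G n)| = n,
        forall n (u : offline (G n)) (v : online (G n)),
          edge u v -> prob u v = p n,
        p =O_\oo (fun n => n%:R^-1 : R),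
        forall n, (0 < n)%N -> 0 < opt (G n)
      & (limn_esup (fun n => simple_greedy_ratio (G n)) <= (2^-1)%:E)%E].
Proof.
exists (half_blocks R), (fun n => n%:R^-1); split => //.
- by move=> n; rewrite card_ord.
- apply/eqOP; near=> k; apply: nearW => n.
  by rewrite ler_peMl.
- exact: half_blocks_opt_gt0.
- apply/lee_addgt0Pr => e e0; rewrite -EFinD.
  (* The sum meets both requirements on [K] at once: [e * K] is 3 e + 2. *)
  pose K := 3 + 2 / e.
  have K3 : 3 <= K by rewrite lerDl divr_ge0 // ltW.
  have eK : 2 <= e * K by rewrite /K mulrDr mulrCA divff ?gt_eqF //; lra.
  pose N := Num.bound (2 * K ^+ 2).
  have NK : 2 * K ^+ 2 < N%:R.
    by apply: archi_boundP; rewrite mulr_ge0 ?sqr_ge0.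
  (* The upper limit is an infimum of suprema over neighborhoods of infinity, so the single tail
     from [N] on suffices. *)
  apply: (@le_trans _ _ (ereal_sup ((fun n => simple_greedy_ratio (half_blocks R n))
      @` [set n | (N <= n)%N]))).
    by apply: ereal_inf_lbound; exists [set n | (N <= n)%N] => //; exists N.
  apply: ge_ereal_sup => _ [n /= Nn <-].
  have Kn : 2 * K ^+ 2 <= n%:R.
    by apply: le_trans (ltW NK) _; rewrite ler_nat.
  apply: (half_blocks_ratio _ e0 K3 eK Kn); rewrite -(ltr_nat R).
  apply: lt_le_trans Kn; rewrite mulr_gt0 // exprn_gt0 //; move: K3; lra.
Unshelve. all: by end_near.
Qed.
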